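(* Let $I$ be a set of items and let $I_{u_1}, I_{u_2}\subseteq I$ be non-empty finite sets. Let $h_i : I\to(0,1)$ be a random hash function such that the values $h_i(v)$, $v\in I$, are independent and each uniformly distributed on $(0,1)$, and define the log-rank $r_i(v)=\lfloor -\log_2 h_i(v)\rfloor$. For $u\in\{u_1,u_2\}$ let $m_u[i]=\max_{w\in I_u} r_i(w)$, and let $s_u[i]\in\{0,1\}$ equal $1$ if and only if there is exactly one $w\in I_u$ with $r_i(w)=m_u[i]$. Define $\chi_{u_1,u_2}[i]=\mathbf{1}(m_{u_1}[i]\ne m_{u_2}[i])$, and $\psi_{u_1,u_2}[i]=s_{u_1}[i]$ if $m_{u_1}[i]>m_{u_2}[i]$, $\psi_{u_1,u_2}[i]=s_{u_2}[i]$ if $m_{u_1}[i]<m_{u_2}[i]$, and $\psi_{u_1,u_2}[i]=-1$ if $m_{u_1}[i]=m_{u_2}[i]$. Let $\delta_{u_1,u_2}[i]=\mathbf{1}(\chi_{u_1,u_2}[i]=1)\,\mathbf{1}(\psi_{u_1,u_2}[i]=1)$. Write $\cup(u_1,u_2)=I_{u_1}\cup I_{u_2}$ and $J_{u_1,u_2}=|I_{u_1}\cap I_{u_2}|/|I_{u_1}\cup I_{u_2}|$. Then: if $|\cup(u_1,u_2)|=1$, $P(\delta_{u_1,u_2}[i]=1)=0$; otherwise \[ P(\delta_{u_1,u_2}[i]=1)=\alpha_{|\cup(u_1,u_2)|}\,(1-J_{u_1,u_2}), \] where for $n\ge 2$, $\alpha_n = n\sum_{j=1}^{\infty}\frac{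1}{2^{j+1}}\left(1-\frac{1}{2^j}\right)^{n-1}$.
   Context: This describes one register $i$ of the MaxLogHash sketch of two sets $I_{u_1}, I_{u_2}$ (the item sets of users $u_1,u_2$); $\lfloor\cdot\rfloor$ is the floor function and $\mathbf{1}(\cdot)$ is the indicator function. *)

(* Defs.v *)
From HB Require Import structures.
From mathcomp Require Import all_boot all_order all_algebra finmap.
From mathcomp Require Import all_classical all_reals all_analysis.

Set Implicit Arguments.
Unset Strict Implicit.
Unset Printing Implicit Defensive.

Import Order.TTheory GRing.Theory Num.Theory.
Import numFieldNormedType.Exports.

Local Open Scope classical_set_scope.
Local Open Scope fset_scope.
Local Open Scope ring_scope.

(* Stated over all finite subfamilies, so that the index type may be
   infinite. *)
Definition mutually_independent (d : measure_display) (T : measurableType d)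
    (R : realType) (P : probability T R) (I : choiceType)
    (X : I -> {RV P >-> R}) : Prop :=
  forall (K : {fset I}) (B : I -> set R),
    (forall v, v \in K -> measurable (B v)) ->
    P (\bigcap_(v in [set` K]) (X v @^-1` B v)) =
    (\prod_(v <- K) P (X v @^-1` B v))%E.

Definition is_uniform01 (d : measure_display) (T : measurableType d)
    (R : realType) (P : probability T R) (X : {RV P >-> R}) : Prop :=
  forall B : set R, measurable B ->
    distribution P X B = uniform_prob (@ltr01 R) B.

(* The maximum of f over A; the value 0 is used only when A is empty. *)
Definition fset_max (I : choiceType) (A : {fset I}) (f : I -> int) : int :=
  if enum_fset A is x :: s then \big[Order.max/f x]_(y <- s) f y else 0.

Section MaxLogHashRegister.
Context {R : realType} {I : choiceType}.

(* g is one realization of the hash function, A, A1 and A2 are item sets. *)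
Implicit Types (g : I -> R) (A : {fset I}).

Definition log_rank g (v : I) : int := Num.floor (- (ln (g v) / ln 2)).

Definition reg_max g A : int := fset_max A (log_rank g).

Definition reg_sole g A : int :=
  (#|` [fset w in A | log_rank g w == reg_max g A]| == 1)%N%:Z.

Definition chi g A1 A2 : int := (reg_max g A1 != reg_max g A2)%:Z.

Definition psi g A1 A2 : int :=
  if reg_max g A2 < reg_max g A1 then reg_sole g A1
  else if reg_max g A1 < reg_max g A2 then reg_sole g A2
  else -1.

Definition delta g A1 A2 : int :=
  (chi g A1 A2 == 1)%:Z * (psi g A1 A2 == 1)%:Z.

Definition jaccard A1 A2 : R := #|` A1 `&` A2|%:R / #|` A1 `|` A2|%:R.

End MaxLogHashRegister.

(* The series has nonnegative terms, so summing it in the extended reals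
   needs no convergence hypothesis. *)
Definition alpha (R : realType) (n : nat) : \bar R :=
  (n%:R%:E *
   \sum_(1 <= j <oo) (1 / 2 ^+ j.+1 * (1 - 1 / 2 ^+ j) ^+ n.-1)%:E)%E.

(* Main.v *)
Require Import Defs.
From HB Require Import structures.
From mathcomp Require Import all_boot all_order all_algebra finmap.
From mathcomp Require Import all_classical all_reals all_analysis.

Set Implicit Arguments.
Unset Strict Implicit.
Unset Printing Implicit Defensive.

Import Order.TTheory GRing.Theory Num.Theory.
Import numFieldNormedType.Exports.

Local Open Scope classical_set_scope.
Local Open Scope fset_scope.
Local Open Scope ring_scope.

(** The register counts (delta = 1) exactly when one item v of the symmetric
    difference of the two item sets has a log-rank strictly above that of every
    other item of the union U. These events are disjoint for distinct v. The
    event for v splits over the log-rank j of v: then h(v) lies in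
    ]2^-(j+1), 2^-j] and every other hash in ]2^-j, 1[, which by independence
    has probability 2^-(j+1) (1 - 2^-j)^(|U|-1). Summing over the
    |U| (1 - J) choices of v gives the formula. *)

(** * Maxima over finite sets *)

Lemma fset_max_ge (I : choiceType) (A : {fset I}) (f : I -> int) (v : I) :
  v \in A -> f v <= fset_max A f.
Proof.
rewrite /fset_max -[v \in A]/(v \in enum_fset A).
case: (enum_fset A) => [//|x s]; rewrite in_cons => /predU1P[->|vs].
  exact: bigmax_ge_id.
exact: le_bigmax_seq.
Qed.

Lemma fset_max_attained (I : choiceType) (A : {fset I}) (f : I -> int) :
  A != fset0 -> exists2 v, v \in A & f v = fset_max A f.
Proof.
case/fset0Pn => v; rewrite -[v \in A]/(v \in enum_fset A) => vA.
suff: exists2 u, u \in enum_fset A & f u = fset_max A f by [].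
rewrite /fset_max; case: (enum_fset A) vA => [//|x s] _.
pose attained m := exists2 u, u \in x :: s & f u = m.
(* The order on [int] is total, so the larger of two attained values is one of them; the initial
   value [f x] is attained at the head of the list. *)
rewrite big_seq; apply: (big_ind attained) => [|a b [u us <-] [w ws <-]|i ixs].
- by exists x; rewrite ?mem_head.
- by rewrite /Order.max; case: ifP => _; [exists w|exists u].
- by exists i; rewrite // in_cons ixs orbT.
Qed.

Lemma fset_max_eq (I : choiceType) (A : {fset I}) (f : I -> int) (v : I) :
  v \in A -> (forall w, w \in A -> f w <= f v) -> fset_max A f = f v.
Proof.
move=> vA fle; apply/eqP; rewrite eq_le fset_max_ge// andbT.
have [|w wA <-] := @fset_max_attained _ A f; last exact: fle.
by apply/fset0Pn; exists v.
Qed.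

(** * Register values for a fixed hash realization *)

Section register.
Context {R : realType} {I : choiceType}.
Implicit Types (g : I -> R) (A : {fset I}).

Lemma reg_soleP g A : A != fset0 ->
  reg_sole g A = 1 <-> exists2 v, v \in A &
    forall w, w \in A -> w != v -> log_rank g w < log_rank g v.
Proof.
move=> A0; rewrite /reg_sole; split.
- case: eqP => // /eqP/cardfs1P[v Av] _.
  have : v \in [fset v] by rewrite in_fset1.
  rewrite -{1}Av !inE/= => /andP[vA /eqP vmax]; exists v => // w wA wv.
  rewrite lt_neqAle vmax fset_max_ge// andbT; apply: contra wv => wmax.
  have : w \in [fset w in A | log_rank g w == reg_max g A] by rewrite !inE wA.
  by rewrite Av in_fset1.
- case=> v vA vlt.
  have vmax : reg_max g A = log_rank g v.
    apply: fset_max_eq => // w wA; have [->//|/(vlt _ wA)] := eqVneq w v.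
    exact: ltW.
  suff -> : [fset w in A | log_rank g w == reg_max g A] = [fset v].
    by rewrite cardfs1.
  apply/fsetP => w; rewrite !inE/= vmax; have [->|wv] := eqVneq w v.
    by rewrite vA eqxx.
  by apply/negP => /andP[wA]; rewrite lt_eqF// vlt.
Qed.

(** The sole maximizer of [A1] also beats every item of [A2], whose maximum is smaller. Hence it
    lies outside [A2], since it cannot beat itself. *)
Lemma strict_max_of_sole g A1 A2 : A1 != fset0 ->
  reg_max g A2 < reg_max g A1 -> reg_sole g A1 = 1 ->
  exists2 v, v \in (A1 `|` A2) `\` (A1 `&` A2) &
    forall w, w \in A1 `|` A2 -> w != v -> log_rank g w < log_rank g v.
Proof.
move=> A10 lt21 /(reg_soleP _ A10)[v vA1 vlt].
have vmax : reg_max g A1 = log_rank g v.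
  apply: fset_max_eq => // w wA; have [->//|/(vlt _ wA)] := eqVneq w v.
  exact: ltW.
have lt2 w : w \in A2 -> log_rank g w < log_rank g v.
  by move=> wA2; rewrite -vmax; apply: le_lt_trans lt21; exact: fset_max_ge.
exists v => [|w].
- by rewrite !inE vA1/= andbT; apply/negP => /lt2; rewrite ltxx.
- by rewrite !inE => /orP[wA1|wA2] wv; [exact: vlt|exact: lt2].
Qed.

(** As [A2] is non-empty, its register value is the log-rank of an actual item and not the default
    0; that item differs from [v] because [v] is outside [A2]. *)
Lemma sole_of_strict_max g A1 A2 v : A2 != fset0 -> v \in A1 -> v \notin A2 ->
  (forall w, w \in A1 `|` A2 -> w != v -> log_rank g w < log_rank g v) ->
  reg_max g A2 < reg_max g A1 /\ reg_sole g A1 = 1.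
Proof.
move=> A20 vA1 vA2 vlt; have A10 : A1 != fset0 by apply/fset0Pn; exists v.
split.
- have [w wA2 wmax] := fset_max_attained (log_rank g) A20.
  rewrite [reg_max g A2]/reg_max -wmax.
  apply: (@lt_le_trans _ _ (log_rank g v)); last exact: fset_max_ge.
  by apply: vlt; [rewrite !inE wA2 orbT|apply: contraNneq vA2 => <-].
- apply/(reg_soleP _ A10); exists v => // w wA1 wv.
  by apply: vlt => //; rewrite !inE wA1.
Qed.

Lemma delta_eq1P g A1 A2 : A1 != fset0 -> A2 != fset0 ->
  delta g A1 A2 = 1 <-> exists2 v, v \in (A1 `|` A2) `\` (A1 `&` A2) &
    forall w, w \in A1 `|` A2 -> w != v -> log_rank g w < log_rank g v.
Proof.
move=> A10 A20; rewrite /delta /chi /psi; split.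
- have [lt12|lt21|eq12] := ltgtP (reg_max g A1) (reg_max g A2).
  + case: (reg_sole g A2 =P 1) => [sole _|]; last by [].
    (* The symmetric difference is unchanged when the two sets are swapped. *)
    rewrite fsetUC fsetIC; exact: strict_max_of_sole.
  + case: (reg_sole g A1 =P 1) => [sole _|]; last by [].
    exact: strict_max_of_sole.
  + by [].
- case=> v; rewrite !inE => /andP[vI /orP[vA1|vA2]] vlt.
  + have vA2 : v \notin A2 by rewrite vA1 in vI.
    have [lt21 ->] := sole_of_strict_max A20 vA1 vA2 vlt.
    by rewrite lt21 (gt_eqF lt21).
  + have vA1 : v \notin A1 by rewrite vA2 andbT in vI.
    rewrite fsetUC in vlt.
    have [lt12 ->] := sole_of_strict_max A10 vA2 vA1 vlt.
    by rewrite lt12 (ltNge (reg_max g A2)) (ltW lt12) (lt_eqF lt12).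
Qed.

(** Comparing a floor with an integer from below amounts to comparing the number itself, and [ln] is
    increasing on positive reals. *)
Lemma log_rank_lt g v (j : nat) : 0 < g v ->
  (log_rank g v < j%:Z) = (2^-1 ^+ j < g v).
Proof.
move=> gv0; have ln2 : 0 < ln (2 : R) by rewrite ln_gt0// ltr1n.
rewrite /log_rank floor_lt_int ltrNl ltr_pdivlMr// mulNr.
have -> : - (j%:~R * ln (2 : R)) = ln (2^-1 ^+ j).
  by rewrite lnXn// lnV ?posrE// mulNrn mulr_natl.
by rewrite ltr_ln ?posrE// exprn_gt0.
Qed.

Lemma log_rank_eq g v (j : nat) : 0 < g v ->
  (log_rank g v == j%:Z) = (2^-1 ^+ j.+1 < g v <= 2^-1 ^+ j).
Proof.
(* Equality with [j] is read as being below [j.+1] but not below [j], whence the half-open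
   interval. *)
by move=> gv0; rewrite eq_le -ltzD1 -PoszD addn1 log_rank_lt// leNgt log_rank_lt// -leNgt.
Qed.

Lemma log_rank_ge0 g v : 0 < g v < 1 -> 0 <= log_rank g v.
Proof.
move=> /andP[gv0 gv1]; rewrite leNgt -[0]/(0%N%:Z) log_rank_lt//.
by rewrite expr0 -leNgt ltW.
Qed.

End register.

(** * Uniform measure of the intervals that occur *)

Lemma uniform_prob01E (R : realType) (B : set R) : measurable B ->
  uniform_prob (@ltr01 R) B = lebesgue_measure (B `&` `[0, 1]).
Proof.
move=> mB; rewrite /uniform_prob integral_uniform_pdf.
rewrite (eq_integral (cst 1%E)); last first.
  move=> x; rewrite inE/= in_itv/= => -[_ x01].
  by rewrite /uniform_pdf x01 subr0 invr1.
by rewrite integral_cst ?mul1e//; exact: measurableI.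
Qed.

Lemma uniform_prob01_itv (R : realType) (a b : R) : 0 <= a -> a <= b -> b <= 1 ->
  uniform_prob (@ltr01 R) `]a, b] = (b - a)%:E.
Proof.
move=> a0 ab b1; rewrite uniform_prob01E// setIidl.
  rewrite lebesgue_measure_itv/= lte_fin; case: ltgtP ab => // -> _.
  by rewrite subrr.
move=> x /=; rewrite !in_itv/= => /andP[/ltW ax xb].
by rewrite (le_trans a0 ax) (le_trans xb b1).
Qed.

Lemma uniform_prob01_ray (R : realType) (a : R) : 0 <= a -> a <= 1 ->
  uniform_prob (@ltr01 R) `]a, +oo[ = (1 - a)%:E.
Proof.
(* The ray and []a, 1]] have the same trace on [[0, 1]]. *)
move=> a0 a1; rewrite -uniform_prob01_itv// !uniform_prob01E//.
congr (lebesgue_measure _); apply/seteqP; split => x /=; rewrite !in_itv/= ?andbT.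
- by move=> [-> /andP[-> ->]].
- by move=> [/andP[-> _] ->].
Qed.

(** * Probability that a given item is the strict maximizer *)

Section strict_max_probability.
Context {d : measure_display} {T : measurableType d} {R : realType}.
Context {P : probability T R} {I : choiceType}.
Variables (h : I -> {RV P >-> R}) (U : {fset I}).
Hypothesis h01 : forall v t, 0 < h v t < 1.
Hypothesis h_indep : mutually_independent h.
Hypothesis h_unif : forall v, is_uniform01 (h v).

Definition strict_max_set (v : I) : set T :=
  [set t | forall w, w \in U -> w != v ->
     log_rank (h^~ t) w < log_rank (h^~ t) v].

(** The ray is left unbounded to match [log_rank_lt]; the uniform law gives no mass beyond 1. *)
Definition strict_max_hash (v : I) (j : nat) (w : I) : set R :=
  if w == v then `]2^-1 ^+ j.+1, 2^-1 ^+ j]%classic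
  else `]2^-1 ^+ j, +oo[%classic.

Definition strict_max_at (v : I) (j : nat) : set T :=
  \bigcap_(w in [set` U]) (h w @^-1` strict_max_hash v j w).

Lemma measurable_strict_max_hash v j w : measurable (strict_max_hash v j w).
Proof. by rewrite /strict_max_hash; case: ifP => _; exact: measurable_itv. Qed.

Lemma measurable_strict_max_at v j : measurable (strict_max_at v j).
Proof.
apply: fin_bigcap_measurable => // w _; rewrite -[_ @^-1` _]setTI.
by apply: measurable_funPT => //; exact: measurable_strict_max_hash.
Qed.

Lemma strict_max_atE v j t : v \in U ->
  strict_max_at v j t <-> log_rank (h^~ t) v = j%:Z /\ strict_max_set v t.
Proof.
move=> vU; have h0 w : 0 < h w t by have /andP[] := h01 w t.
split=> [tvj|[rvj vmax] w /= wU].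
- have rvj : log_rank (h^~ t) v = j%:Z.
    apply/eqP; rewrite log_rank_eq//.
    by have := tvj v vU; rewrite /strict_max_hash eqxx/= in_itv.
  split=> // w wU /negbTE wv; rewrite rvj log_rank_lt//.
  by have := tvj w wU; rewrite /strict_max_hash wv/= in_itv/= andbT.
- rewrite /strict_max_hash; case: eqVneq => [->|wv]/=; rewrite in_itv/=.
    by have := log_rank_eq (g := h^~ t) j (h0 v); rewrite rvj eqxx => <-.
  have := log_rank_lt (g := h^~ t) j (h0 w); rewrite andbT => <-.
  by rewrite -rvj vmax.
Qed.

Lemma strict_max_setE v : v \in U -> strict_max_set v = \bigcup_j strict_max_at v j.
Proof.
move=> vU; apply/seteqP; split=> [t vmax|t [j _ /(strict_max_atE _ _ vU)[]//]].
(* Hashes below 1 have non-negative log-ranks, so natural numbers [j] exhaust all cases. *)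
have := log_rank_ge0 (g := h^~ t) (h01 v t); case rvj: (log_rank (h^~ t) v) => [j|//] _.
by exists j => //; apply/strict_max_atE.
Qed.

Lemma measurable_strict_max_set v : v \in U -> measurable (strict_max_set v).
Proof.
move=> vU; rewrite strict_max_setE//; apply: bigcup_measurable => j _.
exact: measurable_strict_max_at.
Qed.

Lemma probability_strict_max_at v j : v \in U ->
  P (strict_max_at v j) =
  (2^-1 ^+ j.+1 * (1 - 2^-1 ^+ j) ^+ (#|` U|.-1))%:E.
Proof.
move=> vU; have half_le1 : 2^-1 <= 1 :> R by rewrite invf_le1// ler1n.
have pow_ge0 k : 0 <= 2^-1 ^+ k :> R by rewrite exprn_ge0.
have pow_le1 k : 2^-1 ^+ k <= 1 :> R by rewrite exprn_ile1.
rewrite h_indep; last by move=> w _; exact: measurable_strict_max_hash.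
pose p w : R := if w == v then 2^-1 ^+ j.+1 else 1 - 2^-1 ^+ j.
rewrite (eq_bigr (fun w => (p w)%:E)) => [|w _]; last first.
  rewrite -[LHS]/(distribution P (h w) (strict_max_hash v j w)) h_unif; last first.
    exact: measurable_strict_max_hash.
  rewrite /strict_max_hash /p; case: ifP => _; last exact: uniform_prob01_ray.
  rewrite uniform_prob01_itv//; last by rewrite exprS ler_piMl.
  (* The interval is the upper half of [[0, 2^-j]], so its length equals its left endpoint. *)
  by rewrite exprS {1}(splitr (2^-1 ^+ j)) [2^-1 * _]mulrC addrK.
rewrite prodEFin (big_fsetD1 v)//= {1}/p eqxx; congr (_ * _)%:E.
rewrite big_seq (eq_bigr (fun=> 1 - 2^-1 ^+ j)) => [|w]; last first.
  by rewrite !inE /p => /andP[/negbTE -> _].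
by rewrite -big_seq big_const_seq count_predT iter_mulr mulr1 (cardfsD1 v U) vU.
Qed.

Lemma probability_strict_max_set v : v \in U -> (1 < #|` U|)%N ->
  P (strict_max_set v) =
  (\sum_(1 <= j <oo) (1 / 2 ^+ j.+1 * (1 - 1 / 2 ^+ j) ^+ #|` U|.-1)%:E)%E.
Proof.
move=> vU U_gt1; rewrite strict_max_setE// measure_bigcup/=; first last.
(* Disjointness: the index is the log-rank of [v] at [t]. *)
- apply/trivIsetP => i j _ _ ij; rewrite -subset0 => t [].
  move=> /(strict_max_atE _ _ vU)[ri _] /(strict_max_atE _ _ vU)[rj _].
  by move: ij; rewrite -eqz_nat -ri -rj eqxx.
- by move=> j _; exact: measurable_strict_max_at.
rewrite (eq_eseriesl (Q := xpredT)); last by move=> j; rewrite in_setT.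
rewrite nneseries_recl//= probability_strict_max_at// expr0 subrr.
(* The series of alpha starts at 1: the term of index 0 vanishes because U has
   another item, whose log-rank cannot be negative. *)
have -> : 0 ^+ #|` U|.-1 = 0 :> R by rewrite expr0n -subn1 subn_eq0 leqNgt U_gt1.
rewrite mulr0 add0e.
apply: eq_eseriesr => j _.
by rewrite probability_strict_max_at// !exprVn !div1r.
Qed.

End strict_max_probability.

Theorem theorem1 (d : measure_display) (T : measurableType d) (R : realType)
    (P : probability T R) (I : choiceType) (I1 I2 : {fset I})
    (I1_neq0 : I1 != fset0) (I2_neq0 : I2 != fset0)
    (h : I -> {RV P >-> R})
    (h01 : forall v t, 0 < h v t < 1)
    (h_indep : mutually_independent h)
    (h_unif : forall v, is_uniform01 (h v)) :
  let U := I1 `|` I2 in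
  let E := [set t : T | delta (fun v => h v t) I1 I2 = 1] in
  (#|` U| = 1%N -> P E = 0%E) /\
  (#|` U| <> 1%N -> P E = (alpha R #|` U| * (1 - jaccard I1 I2)%:E)%E).
Proof.
move=> U E.
pose S := U `\` (I1 `&` I2).
have EE : E = (\bigcup_(v in [set` S]) strict_max_set h U v)%classic.
  apply/seteqP; split=> t.
  - by move=> /(delta_eq1P _ I1_neq0 I2_neq0)[v vU vmax]; exists v.
  - by move=> [v vU vmax]; apply/(delta_eq1P _ I1_neq0 I2_neq0); exists v.
have subIU : I1 `&` I2 `<=` U.
  exact: fsubset_trans (fsubsetIl _ _) (fsubsetUl _ _).
split=> [/eqP/cardfs1P[x Ux]|/eqP U_neq1].
  (* Both item sets equal the one-element union, so [S] is empty and no item can witness the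
     event. *)
  have full A : A != fset0 -> A `<=` U -> A = [fset x].
    by rewrite Ux fsubset1 => /negbTE -> /orP[/eqP|//].
  have I1x := full _ I1_neq0 (fsubsetUl _ _).
  have I2x := full _ I2_neq0 (fsubsetUr _ _).
  by rewrite EE /S Ux I1x I2x fsetIid fsetDv bigcup_fset big_seq_fset0 measure0.
have U_gt0 : (0 < #|` U|)%N.
  rewrite cardfs_gt0 -fsubset0; apply: contra I1_neq0; rewrite -fsubset0.
  by apply: fsubset_trans; exact: fsubsetUl.
have U_gt1 : (1 < #|` U|)%N by rewrite ltn_neqAle eq_sym U_neq1.
have inU v : v \in S -> v \in U by rewrite inE => /andP[].
rewrite EE bigcup_fset measure_fbigsetU; first last.
(* Two distinct strict maximizers would each exceed the other. *)
- apply/trivIsetP => v w /inU vU /inU wU vw; rewrite -subset0 => t [vmax wmax].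
  have := lt_trans (vmax w wU _) (wmax v vU vw).
  by rewrite ltxx eq_sym => /(_ vw).
- by move=> v /inU vU; exact: measurable_strict_max_set.
(* This value does not depend on [v], so the finite sum is [c] taken once for each item of [S]. *)
pose c : \bar R :=
  (\sum_(1 <= j <oo) (1 / 2 ^+ j.+1 * (1 - 1 / 2 ^+ j) ^+ #|` U|.-1)%:E)%E.
rewrite (eq_big_seq (fun=> c)) => [|v /inU vU]; last first.
  exact: probability_strict_max_set.
rewrite /alpha -/c muleAC.
(* Multiplying out leaves the size of the union minus that of the intersection, which is the size of
   [S]; the division cancels because [U] is non-empty. *)
have -> : (#|` U|%:R%:E * (1 - jaccard I1 I2)%:E)%E = #|` S|%:R%:E :> \bar R.
  rewrite -EFinM /jaccard mulrBr mulr1 mulrCA divff ?pnatr_eq0 -?lt0n// mulr1.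
  by rewrite cardfsDS// natrB// fsubset_leq_card.
by rewrite mule_natl big_const_seq count_predT iter_addr_0.
Qed.
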